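(* Let $q\ge1$ and $k\ge0$ be integers, and let $G$ be a simple connected graph with $n\ge 2$ nodes and $m$ edges. Let $K_{q,k}$ denote Kemeny's constant of the iterated $q$-subdivision graph $S_{q,k}(G)$. Then: (i) if $q=2$, $$K_{2,k}=4^kK_{2,0}+\frac{mk4^k}{3}+\Big(\frac{4m+3}{6}-n\Big)\frac{4^k-1}{3};$$ (ii) if $q\neq2$, $$K_{q,k}=4^kK_{q,0}+\frac{mq(q-1)}{(q-2)(2q-1)}\left[(2q)^k-4^k\right]+\Big(\frac{2mq+2q-1}{2(2q-1)}-n\Big)\frac{4^k-1}{3}.$$
   Context: The $q$-subdivision graph $S_q(G)$ is obtained from $G$ by replacing each edge $uv$ with $q$ disjoint paths of length $2$: $ux_1v,\ldots,ux_qv$. The iterated $q$-subdivision graphs are $S_{q,0}(G)=G$ and $S_{q,k}(G)=S_q(S_{q,k-1}(G))$ for $k\ge1$. For a connected graph with $m$ edges and degrees $d_j$, Kemeny's constant is $K=\sum_{j}\pi_jT_{ij}$, where $\pi_j=d_j/(2m)$ is the stationary distribution of the unbiased random walk (at each step, jump to a uniformly random neighbor) and $T_{ij}$ is the expected number of steps to first reach $j$ from $i$, with $T_{ii}=0$. This value is independent of the starting node $i$. *)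

(* Defs.v *)
From HB Require Import structures.
From mathcomp Require Import all_boot all_order all_algebra.
From mathcomp Require Import all_classical all_reals all_analysis.

Set Implicit Arguments.
Unset Strict Implicit.
Unset Printing Implicit Defensive.

Import Order.TTheory GRing.Theory Num.Theory.

Local Open Scope ring_scope.

Record sgraph := SGraph {
  vertex :> finType;
  adj : rel vertex;
  adj_sym : symmetric adj;
  adj_irrefl : irreflexive adj }.

Definition sgraph_connected (G : sgraph) : Prop :=
  forall x y : G, connect (@adj G) x y.

Definition edges (G : sgraph) : {set {set G}} :=
  [set [set x; y] | x in [set: G], y in [set: G] & adj x y].

Definition deg (G : sgraph) (x : G) : nat := #|[set y | adj x y]|.

(* The vertex [inr (e, l)] is the midpoint of the [l]-th path of length 2 that
   replaces the edge [e]. *)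
Definition subdiv_vertex (q : nat) (G : sgraph) : finType :=
  (G + {e : {set G} | e \in edges G} * 'I_q)%type.

Definition subdiv_adj (q : nat) (G : sgraph) : rel (subdiv_vertex q G) :=
  fun a b => match a, b with
  | inl v, inr (e, _) => v \in val e
  | inr (e, _), inl v => v \in val e
  | _, _ => false
  end.

Lemma subdiv_adj_sym (q : nat) (G : sgraph) : symmetric (@subdiv_adj q G).
Proof. by move=> [u|[e l]] [v|[f r]]. Qed.

Lemma subdiv_adj_irrefl (q : nat) (G : sgraph) :
  irreflexive (@subdiv_adj q G).
Proof. by move=> [u|[e l]]. Qed.

Definition subdiv (q : nat) (G : sgraph) : sgraph :=
  SGraph (@subdiv_adj_sym q G) (@subdiv_adj_irrefl q G).

Definition iter_subdiv (q k : nat) (G : sgraph) : sgraph :=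
  iter k (subdiv q) G.

Section RandomWalk.
Variables (R : realType) (G : sgraph).
Implicit Types (x y i j : G).

Definition step_prob x y : R := (adj x y)%:R / (deg x)%:R.

(* Probability that the walk started at [x] begins with the steps [p]. *)
Fixpoint walk_prob x (p : seq G) : R :=
  if p is y :: p' then step_prob x y * walk_prob y p' else 1.

(* Probability that the first time [t >= 0] at which the walk started at [i]
   is at [j] equals [t]; in particular this time is 0 when [i = j]. *)
Definition first_hit_prob i j (t : nat) : R :=
  \sum_(p : t.-tuple G | (last i p == j) && (j \notin belast i p))
    walk_prob i p.

(* Expectation of the first hitting time, as an extended real: the hitting time
   is +oo on the event that [j] is never reached.  With [0 * +oo = 0], the
   second term vanishes when [j] is reached almost surely. *)
Definition hitting_time i j : \bar R :=
  (\sum_(0 <= t <oo) (t%:R * first_hit_prob i j t)%:E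
   + +oo * (1 - \sum_(0 <= t <oo) (first_hit_prob i j t)%:E))%E.

Definition stationary j : R := (deg j)%:R / (2 * #|edges G|%:R).

Definition kemeny i : \bar R :=
  (\sum_(j : G) (stationary j)%:E * hitting_time i j)%E.

End RandomWalk.

(* Main.v *)
Require Import Defs.
From HB Require Import structures.
From mathcomp Require Import all_boot all_order all_algebra.
From mathcomp Require Import ring lra.
From mathcomp Require Import all_classical all_reals all_analysis.

Set Implicit Arguments.
Unset Strict Implicit.
Unset Printing Implicit Defensive.

Import Order.TTheory GRing.Theory Num.Theory.
Import numFieldNormedType.Exports.

Local Open Scope ring_scope.

(** Write P for the transition matrix of the walk, pi for its stationary
law and 1 pi for the matrix all of whose rows are pi. Call H a potential when
(I - P) H = I - 1 pi. For j fixed, h(i) = (H j j - H i j) / pi_j vanishes at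
[j] and satisfies the first-step equations h(i) = 1 + (P h)(i) for i <> j; on
a connected graph these equations have only one solution, the expected hitting
times of [j] ([hitting_time_first_step]). Summing against pi gives
K = tr H - sum_j H i j for every potential H ([kemeny_potential]), and the row
sums of H do not depend on the row because they form a harmonic function.
So Kemeny's constant can be read off from any potential.

A potential of the subdivision can be written in terms of one of [G]. Two
steps of the subdivided walk starting at an old vertex are one step of the
lazy walk (I + P) / 2 on [G], since a midpoint leads to each end of its edge
with probability 1/2. Eliminating the midpoints from the equation for the new
potential therefore leaves an equation in (I - P) / 2, which H solves; this is
[subdiv_potential]. Its row sums are 4 times those of H and its trace is
4 tr H + q m - n + 1/2, so that

  K(S_q(G)) = 4 K(G) + q m - n + 1/2        ([kemeny_subdiv]).

The k-th iterate has (2q)^k m edges and n + q m ((2q)^k - 1) / (2q - 1)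
vertices. The two closed forms are the solutions of the resulting linear
recurrence; the case q = 2 is the resonant one, where 2q = 4. *)

(** * Sums over edges and degrees *)

Lemma edgesP (G : sgraph) (e : {set G}) :
  reflect (exists2 p : G * G, adj p.1 p.2 & e = [set p.1; p.2]) (e \in edges G).
Proof.
apply: (iffP imset2P) => [[x y _]|[[x y] /= xy ->]].
  by rewrite !inE /= => xy ->; exists (x, y).
by exists x y; rewrite ?inE.
Qed.

Lemma adj_neq (G : sgraph) (x y : G) : adj x y -> x != y.
Proof. by move=> xy; apply/eqP => xEy; rewrite xEy adj_irrefl in xy. Qed.

Lemma sum_endpoints (G : sgraph) (V : nmodType) (x y : G) (g : G -> V) :
  adj x y -> \sum_(w in [set x; y]) g w = g x + g y.
Proof. by move=> xy; rewrite big_setU1 ?inE ?adj_neq//= big_set1. Qed.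

(** Over a simple graph the edges at [x] correspond to the neighbours of [x]. *)
Lemma sum_incident_edges (G : sgraph) (V : nmodType) (x : G)
    (F : {set G} -> V) :
  \sum_(e in edges G | x \in e) F e = \sum_(y | adj x y) F [set x; y].
Proof.
have setE :
    [set e in edges G | x \in e] = [set [set x; y] | y in [set y | adj x y]].
  apply/setP => e; rewrite !inE; apply/andP/imsetP => [[/edgesP [[u v] /= uv ->]]|].
    rewrite !inE => /orP[] /eqP ->; first by exists v; rewrite ?inE.
    by exists u; rewrite ?inE 1?adj_sym// finset.setUC.
  move=> [y]; rewrite inE => xy ->; split; last by rewrite !inE eqxx.
  by apply/edgesP; exists (x, y).
transitivity (\sum_(e in [set e in edges G | x \in e]) F e).
  by apply: eq_bigl => e; rewrite inE.
rewrite setE big_imset /=; first by apply: eq_bigl => y; rewrite inE.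
move=> y z; rewrite !inE => /adj_neq xy /adj_neq xz /setP /(_ y).
by rewrite !inE eqxx orbT eq_sym (negbTE xy) /= => /esym/eqP.
Qed.

(** The pairs of an edge and one of its ends are the oriented edges. *)
Lemma sum_edges_endpoints (G : sgraph) (V : nmodType)
    (F : {set G} -> G -> V) :
  \sum_(e in edges G) \sum_(x in e) F e x =
  \sum_(x : G) \sum_(y | adj x y) F [set x; y] x.
Proof.
rewrite (exchange_big_dep predT)//=; apply: eq_bigr => x _.
exact: (sum_incident_edges x (F ^~ x)).
Qed.

Lemma natr_deg (R : pzSemiRingType) (G : sgraph) (x : G) :
  (deg x)%:R = \sum_(y | adj x y) 1 :> R.
Proof. by rewrite /deg -sum1_card natr_sum; apply: eq_bigl => y; rewrite inE. Qed.

Lemma sum_deg (R : pzSemiRingType) (G : sgraph) :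
  \sum_(x : G) (deg x)%:R = 2 * #|edges G|%:R :> R.
Proof.
under eq_bigr do rewrite natr_deg.
rewrite -(sum_edges_endpoints (fun _ _ => 1)) -sum1_card natr_sum mulr_sumr.
apply: eq_bigr => e /edgesP [[x y] /= xy ->].
by rewrite sum_endpoints// mulr1.
Qed.

Lemma deg_gt0 (G : sgraph) :
  sgraph_connected G -> (2 <= #|{: G}|)%N -> forall x : G, (0 < deg x)%N.
Proof.
move=> Gc n2 x; have [y] : exists y, y \in predC1 x.
  by apply/card_gt0P; rewrite cardC1 -ltnS prednK// ltnW.
rewrite inE => yx; have /connectP [[|z p] /= pP yE] := Gc x y.
  by rewrite yE eqxx in yx.
by apply/card_gt0P; exists z; rewrite inE; case/andP: pP.
Qed.

Lemma edges_gt0 (G : sgraph) :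
  sgraph_connected G -> (2 <= #|{: G}|)%N -> (0 < #|edges G|)%N.
Proof.
move=> Gc n2; have /card_gt0P [x _] : (0 < #|{: G}|)%N by exact: ltnW.
have /card_gt0P [y] := deg_gt0 Gc n2 x; rewrite inE => xy.
by apply/card_gt0P; exists [set x; y]; apply/edgesP; exists (x, y).
Qed.

(** * Harmonic functions of the walk *)

Definition walk_mean (R : realType) (G : sgraph) (g : G -> R) (x : G) : R :=
  \sum_y step_prob R x y * g y.

Lemma walk_meanE (R : realType) (G : sgraph) (g : G -> R) (x : G) :
  walk_mean g x = (\sum_(y | adj x y) g y) / (deg x)%:R.
Proof.
rewrite /walk_mean /step_prob mulr_suml [RHS]big_mkcond /=.
by apply: eq_bigr => y _; case: (adj x y) => /=; lra.
Qed.


Section Walk.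
Variables (R : realType) (G : sgraph).
Hypotheses (G_conn : sgraph_connected G) (n_ge2 : (2 <= #|{: G}|)%N).
Implicit Types (x y i j k : G) (g h : G -> R).

Let degR_gt0 x : 0 < (deg x)%:R :> R.
Proof. by rewrite ltr0n deg_gt0. Qed.

Let degR_neq0 x : (deg x)%:R != 0 :> R.
Proof. by rewrite gt_eqF. Qed.

Lemma step_prob_ge0 x y : 0 <= step_prob R x y.
Proof. by rewrite divr_ge0. Qed.

Lemma walk_mean_cst (c : R) x : walk_mean (fun=> c) x = c.
Proof.
rewrite walk_meanE (eq_bigr (fun=> 1 * c)) => [|y _]; last by rewrite mul1r.
by rewrite -mulr_suml -natr_deg mulrAC divff// mul1r.
Qed.

Lemma walk_meanD g h x :
  walk_mean (fun y => g y + h y) x = walk_mean g x + walk_mean h x.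
Proof. by rewrite -big_split; apply: eq_bigr => y _; rewrite mulrDr. Qed.

Lemma walk_meanB g h x :
  walk_mean (fun y => g y - h y) x = walk_mean g x - walk_mean h x.
Proof. by rewrite -sumrB; apply: eq_bigr => y _; rewrite mulrBr. Qed.

Lemma walk_meanM g (c : R) x :
  walk_mean (fun y => g y * c) x = walk_mean g x * c.
Proof. by rewrite mulr_suml; apply: eq_bigr => y _; rewrite mulrA. Qed.

Lemma le_walk_mean g h x :
  (forall y, g y <= h y) -> walk_mean g x <= walk_mean h x.
Proof. by move=> gh; apply: ler_sum => y _; rewrite ler_wpM2l ?step_prob_ge0. Qed.

(** Maximum principle. Where a mean over neighbours equals an upper bound of
the averaged values, all of these are equal to it. If the maximum were not
attained at [j], then the set where it is attained would be closed under
adjacency, and connectedness would carry it to [j]. *)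
Lemma harmonic_off_le g j :
  (forall i, i != j -> g i = walk_mean g i) -> forall i, g i <= g j.
Proof.
move=> gH i; have [z _ zmax] := arg_maxP g (erefl : xpredT i).
apply: le_trans (zmax i isT) _; rewrite leNgt; apply/negP => jz.
pose a := [pred y | g y == g z].
have aC : fingraph.closed (@adj G) a.
  apply: (intro_closed (sym_connect_sym (@adj_sym G))) => x y xy /=.
  rewrite !inE => /eqP xz; have xj : x != j.
    by apply/eqP => xj; rewrite -xz xj ltxx in jz.
  have gx := gH x xj; have : \sum_(w | adj x w) (g z - g w) = 0.
    have : walk_mean (fun w => g z - g w) x = 0.
      by rewrite walk_meanB walk_mean_cst -gx xz subrr.
    rewrite walk_meanE => /eqP; rewrite mulf_eq0 invr_eq0 (negbTE (degR_neq0 x)).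
    by rewrite orbF => /eqP.
  move/psumr_eq0P => /(_ _ y xy) E.
  by rewrite -subr_eq0 -oppr_eq0 opprB E// => w _; rewrite subr_ge0; exact: zmax.
have := closed_connect aC (G_conn z j); rewrite !inE eqxx => /esym/eqP jE.
by rewrite jE ltxx in jz.
Qed.

Lemma harmonic_off_cst g j :
  (forall i, i != j -> g i = walk_mean g i) -> forall i, g i = g j.
Proof.
move=> gH i; apply/eqP; rewrite eq_le harmonic_off_le//= -lerN2.
apply: (@harmonic_off_le (fun y => - g y)) => k kj; rewrite gH//.
by rewrite -sumrN; apply: eq_bigr => y _; rewrite mulrN.
Qed.

Lemma stationary_gt0 j : 0 < stationary R j.
Proof. by rewrite divr_gt0// mulr_gt0// ltr0n edges_gt0. Qed.

Lemma sum_stationary : \sum_(j : G) stationary R j = 1.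
Proof.
rewrite -mulr_suml sum_deg divff// mulf_neq0// pnatr_eq0 -lt0n.
exact: edges_gt0.
Qed.

(** Stationarity, in the form pi P = pi applied to [g]: both sides are the sum
of g y over all oriented edges (x, y), divided by twice the number of edges. *)
Lemma stationary_walk_mean g :
  \sum_x stationary R x * walk_mean g x = \sum_x stationary R x * g x.
Proof.
transitivity (\sum_x \sum_y (adj x y)%:R / (2 * #|edges G|%:R) * g y).
  apply: eq_bigr => x _; rewrite mulr_sumr; apply: eq_bigr => y _.
  rewrite /stationary /step_prob.
  by have := degR_neq0 x; set d := (deg x)%:R => d0; field; rewrite d0 pnatr_eq0 -lt0n edges_gt0.
rewrite exchange_big /=; apply: eq_bigr => y _.
rewrite -!mulr_suml; congr (_ / _ * _).
rewrite natr_deg [RHS]big_mkcond /=.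
by apply: eq_bigr => x _; rewrite adj_sym; case: adj.
Qed.


(** * Hitting times *)

Lemma first_hit_prob0 i j : first_hit_prob R i j 0 = (i == j)%:R.
Proof.
rewrite /first_hit_prob big_mkcond (eq_bigr (fun=> (i == j)%:R)) /= => [|p _].
  by rewrite sumr_const card_tuple expn0.
by rewrite tuple0 /=; case: eqP.
Qed.

(** First-step analysis. The factor [i != j] is the requirement that the walk
has not already hit [j] at time 0. *)
Lemma first_hit_probS i j t :
  first_hit_prob R i j t.+1 =
  (i != j)%:R * walk_mean (fun k => first_hit_prob R k j t) i.
Proof.
rewrite /first_hit_prob.
rewrite (reindex (fun kp : G * t.-tuple G => [tuple of kp.1 :: kp.2])) /=; last first.
  exists (fun p : t.+1.-tuple G => (thead p, [tuple of behead p])) => [[k p] _|p _] /=.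
    by congr pair; apply: val_inj.
  by rewrite -tuple_eta.
rewrite big_mkcond -(pair_big_dep xpredT (fun _ _ => true)
  (fun k (p : t.-tuple G) => if (last k p == j) && (j \notin i :: belast k p)
     then step_prob R i k * walk_prob R k p else 0)) /=.
rewrite /walk_mean mulr_sumr; apply: eq_bigr => k _.
rewrite -big_mkcond mulrCA mulr_sumr mulr_sumr big_mkcond [RHS]big_mkcond /=.
apply: eq_bigr => p _; rewrite inE negb_or [j == i]eq_sym.
case: (i == j); case: (last k p == j); case: (j \in belast k p) => //=.
all: by rewrite ?mul1r ?mul0r ?mulr0.
Qed.

Lemma first_hit_prob_ge0 i j t : 0 <= first_hit_prob R i j t.
Proof.
elim: t i => [|t IH] i; first by rewrite first_hit_prob0.
rewrite first_hit_probS mulr_ge0// -(walk_mean_cst 0 i).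
exact: le_walk_mean.
Qed.

(** Here [u N] will be a quantity of the walk truncated at time [N]. Its limit
exists by monotonicity and satisfies the first-step equations of [h]; the
difference of the two is harmonic off [j] and vanishes at [j]. *)
Lemma first_step_cvg (j : G) (u c : nat -> G -> R) (h d : G -> R) :
  (forall i, nondecreasing_seq (u ^~ i)) ->
  (forall N i, u N i <= h i) ->
  (forall i, c N i @[N --> \oo] --> d i)%classic ->
  (forall N i, i != j -> u N.+1 i = walk_mean (fun k => u N k + c N k) i) ->
  (forall i, i != j -> h i = walk_mean (fun k => h k + d k) i) ->
  (u N j @[N --> \oo] --> h j)%classic ->
  forall i, (u N i @[N --> \oo] --> h i)%classic.
Proof.
move=> u_nd u_le c_d u_step h_step uj.
pose l i := limn (u ^~ i).
have ul i : (u N i @[N --> \oo] --> l i)%classic.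
  apply: nondecreasing_is_cvgn (u_nd i) _.
  by exists (h i) => _ [N _ <-].
have l_step i : i != j -> l i = walk_mean (fun k => l k + d k) i.
  move=> ij; have : (u N.+1 i @[N --> \oo] --> walk_mean (fun k => l k + d k) i)%classic.
    rewrite (_ : (fun N => u N.+1 i) =
                 (fun N => walk_mean (fun k => u N k + c N k) i)); last first.
      by apply/funext => N; exact: u_step.
    apply: cvg_big => [|k _]; first exact: add_continuous.
    by apply: cvgMr; apply: cvgD.
  by rewrite (cvg_shiftS (u ^~ i)); apply: cvg_lim.
have lj : l j = h j by exact: (cvg_lim (@Rhausdorff R) uj).
suff lh i : l i = h i by move=> i; rewrite -lh.
have := @harmonic_off_cst (fun i => l i - h i) j.
rewrite lj subrr => E; apply/eqP; rewrite -subr_eq0 E// => k kj.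
by rewrite l_step// h_step// -walk_meanB; apply: eq_bigr => y _; congr (_ * _); ring.
Qed.

(** The truncated probabilities [F] of having hit [j] satisfy the first-step
equations of the constant 1, so [j] is reached almost surely and the infinite
term of the hitting time disappears. The truncated expectations [M] are bounded
by [h], which is nonnegative by the minimum principle, and [F] plays the part of
the running cost 1 in their first-step equations. *)
Lemma hitting_time_first_step (j : G) (h : G -> R) :
  h j = 0 -> (forall i, i != j -> h i = 1 + walk_mean h i) ->
  forall i, hitting_time R i j = (h i)%:E.
Proof.
move=> hj h_step.
pose F N i := \sum_(0 <= t < N) first_hit_prob R i j t.
pose M N i := \sum_(0 <= t < N) t%:R * first_hit_prob R i j t.
have FS N i : F N.+1 i = (i == j)%:R + (i != j)%:R * walk_mean (F N) i.
  rewrite /F big_nat_recl// first_hit_prob0; congr (_ + _).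
  under eq_bigr do rewrite first_hit_probS.
  rewrite -mulr_sumr exchange_big /=; congr (_ * _).
  by apply: eq_bigr => k _; rewrite mulr_sumr.
have MS N i : M N.+1 i = (i != j)%:R * walk_mean (fun k => M N k + F N k) i.
  rewrite /M big_nat_recl// mul0r add0r.
  under eq_bigr do rewrite first_hit_probS mulrCA.
  rewrite -mulr_sumr; congr (_ * _).
  under eq_bigr do rewrite mulr_sumr.
  rewrite exchange_big /=; apply: eq_bigr => k _.
  rewrite /F -big_split mulr_sumr /=; apply: eq_bigr => t _.
  by rewrite -natr1; ring.
have F_nd i : nondecreasing_seq (F ^~ i).
  apply/nondecreasing_seqP => N; rewrite /F big_nat_recr//= lerDl.
  exact: first_hit_prob_ge0.
have M_nd i : nondecreasing_seq (M ^~ i).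
  apply/nondecreasing_seqP => N; rewrite /M big_nat_recr//= lerDl.
  by rewrite mulr_ge0 ?first_hit_prob_ge0.
have F_le1 N i : F N i <= 1.
  elim: N i => [|N IH] i; first by rewrite /F big_nil.
  rewrite FS; case: eqP => _ /=; first by rewrite mul0r addr0.
  by rewrite add0r mul1r -[leRHS](walk_mean_cst 1 i) le_walk_mean.
have h_ge0 i : 0 <= h i.
  (* A minimum attained away from [j] would be at least 1 plus itself. *)
  have [z _ zmin] := arg_minP h (erefl : xpredT i).
  apply: le_trans (zmin i isT); have [->|zj] := eqVneq z j; first by rewrite hj.
  have : h z <= walk_mean h z.
    by rewrite -{1}(walk_mean_cst (h z) z) le_walk_mean// => y; exact: zmin.
  by rewrite {1}(h_step z)//; lra.
have M_le N i : M N i <= h i.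
  elim: N i => [|N IH] i; first by rewrite /M big_nil.
  rewrite MS; have [->|ij] := eqVneq i j; first by rewrite mul0r hj.
  rewrite mul1r h_step// addrC -[X in _ <= _ + X](walk_mean_cst 1 i) -walk_meanD.
  by apply: le_walk_mean => k; apply: lerD.
have F_cvg : forall i, (F N i @[N --> \oo] --> (1 : R))%classic.
  apply: (@first_step_cvg j F (fun _ _ => 0) (fun=> 1) (fun=> 0)) => //.
  - by move=> i; exact: cvg_cst.
  - move=> N i ij; rewrite FS (negbTE ij) add0r mul1r.
    by apply: eq_bigr => k _; rewrite addr0.
  - by move=> i _; rewrite addr0 walk_mean_cst.
  - rewrite -(cvg_shiftS (F ^~ j)) /= (_ : (fun N => F N.+1 j) = (fun=> 1)).
      exact: cvg_cst.
    by apply/funext => N; rewrite FS eqxx mul0r addr0.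
have M_cvg : forall i, (M N i @[N --> \oo] --> h i)%classic.
  apply: (@first_step_cvg j M F h (fun=> 1)) => //.
  - by move=> N i ij; rewrite MS ij mul1r.
  - by move=> i ij; rewrite walk_meanD walk_mean_cst h_step// addrC.
  - rewrite -(cvg_shiftS (M ^~ j)) /= (_ : (fun N => M N.+1 j) = (fun=> h j)).
      exact: cvg_cst.
    by apply/funext => N; rewrite MS eqxx mul0r hj.
have esum (f : nat -> R) (s : R) :
    (\sum_(0 <= t < N) f t @[N --> \oo] --> s)%classic ->
  (\sum_(0 <= t <oo) (f t)%:E = s%:E)%E.
  move=> fs; apply: cvg_lim => //.
  under eq_fun do rewrite sumEFin.
  by apply: cvg_EFin => //; exact: nearW.
move=> i; rewrite /hitting_time (esum _ _ (M_cvg i)) (esum _ _ (F_cvg i)).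
by rewrite subee// mule0 adde0.
Qed.

(** * Potentials *)

Definition potential (H : G -> G -> R) : Prop :=
  forall i j, H i j - walk_mean (H ^~ j) i = (i == j)%:R - stationary R j.

(** The inverse Z of I - P + 1 pi, the fundamental matrix of the chain, is a
potential. For the equation (I - P) v + 1 (pi v) = c, multiplication by pi on
the left gives pi v = pi c. With c = 0 this leaves a harmonic function of
mean 0, hence injectivity; with the columns of the identity it gives pi Z = pi. *)
Lemma exists_potential : exists H, potential H.
Proof.
pose A : 'M[R]_#|G| := \matrix_(i, j) ((enum_val i == enum_val j)%:R
  - step_prob R (enum_val i) (enum_val j) + stationary R (enum_val j)).
have A_mul (v : G -> R) x :
    \sum_j A (enum_rank x) j * v (enum_val j) =
    v x - walk_mean v x + \sum_y stationary R y * v y.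
  rewrite (reindex_onto enum_rank enum_val) => [|i _]; last exact: enum_valK.
  rewrite (eq_bigl xpredT) => [|y]; last by rewrite enum_rankK eqxx.
  under eq_bigr do rewrite mxE !enum_rankK mulrDl mulrBl.
  rewrite big_split sumrB /=; congr (_ - _ + _).
  rewrite (bigD1 x)//= eqxx mul1r big1 ?addr0// => y yx.
  by rewrite eq_sym (negbTE yx) mul0r.
have pi_inv (v : G -> R) c :
    (forall x, v x - walk_mean v x + \sum_y stationary R y * v y = c x) ->
    \sum_y stationary R y * v y = \sum_y stationary R y * c y.
  move=> vc; under [RHS]eq_bigr do rewrite -vc mulrDr mulrBr.
  rewrite big_split sumrB /= stationary_walk_mean subrr add0r.
  by rewrite -mulr_suml sum_stationary mul1r.
have A_unit : A \in unitmx.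
  rewrite -unitmx_tr -row_free_unit; apply: inj_row_free => v vA.
  pose w x := v ord0 (enum_rank x).
  have wA x : w x - walk_mean w x + \sum_y stationary R y * w y = 0.
    rewrite -A_mul; have := congr1 (fun B : 'rV_#|G| => B ord0 (enum_rank x)) vA.
    rewrite !mxE => E; rewrite -[RHS]E; apply: eq_bigr => j _.
    by rewrite [A^T _ _]mxE mulrC /w enum_valK.
  have w0 : \sum_y stationary R y * w y = 0.
    by rewrite (pi_inv _ _ wA) big1// => y _; rewrite mulr0.
  have wc x y : w x = w y.
    apply: harmonic_off_cst => i _.
    by have := wA i; rewrite w0 addr0 => /eqP; rewrite subr_eq0 => /eqP.
  apply/rowP => j; rewrite mxE -[j]enum_valK -/(w _).
  move: w0; under eq_bigr do rewrite (wc _ (enum_val j)).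
  by rewrite -mulr_suml sum_stationary mul1r.
pose Z x y := invmx A (enum_rank x) (enum_rank y).
have AZ x y : Z x y - walk_mean (Z ^~ y) x
    + \sum_k stationary R k * Z k y = (x == y)%:R.
  rewrite -(A_mul (Z ^~ y)) /Z; under eq_bigr do rewrite enum_valK.
  have := congr1 (fun B : 'M[R]_#|G| => B (enum_rank x) (enum_rank y)) (mulmxV A_unit).
  by rewrite !mxE (inj_eq enum_rank_inj).
exists Z => i j; rewrite -[in RHS](AZ i j).
suff -> : stationary R j = \sum_k stationary R k * Z k j by rewrite addrK.
rewrite (pi_inv _ _ (AZ ^~ j)) (bigD1 j)//= eqxx mulr1 big1 ?addr0// => y yj.
by rewrite (negbTE yj) mulr0.
Qed.

(** The weight [stationary R j] cancels the denominator of the hitting time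
(H j j - H i j) / pi_j. *)
Lemma kemeny_potential (H : G -> G -> R) i :
  potential H -> kemeny R i = (\sum_j (H j j - H i j))%:E.
Proof.
move=> HP; rewrite -sumEFin; apply: eq_bigr => j _.
have pj := stationary_gt0 j.
rewrite (@hitting_time_first_step j (fun k => (H j j - H k j) / stationary R j)).
- by rewrite -EFinM mulrC divfK// gt_eqF.
- by rewrite subrr mul0r.
move=> k kj; rewrite walk_meanM walk_meanB walk_mean_cst.
have := HP k j; rewrite (negbTE kj) sub0r => HPk.
have -> : walk_mean (H ^~ j) k = H k j + stationary R j by lra.
by field; rewrite gt_eqF.
Qed.

(** The row sums are harmonic, since the rows of I - 1 pi sum to 0. *)
Lemma potential_sum_cst (H : G -> G -> R) i k :
  potential H -> \sum_j H i j = \sum_j H k j.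
Proof.
move=> HP; apply: (@harmonic_off_cst (fun i => \sum_j H i j)) => x _.
apply/eqP; rewrite -subr_eq0; apply/eqP.
transitivity (\sum_j (H x j - walk_mean (H ^~ j) x)).
  rewrite sumrB; congr (_ - _); rewrite exchange_big /=.
  by apply: eq_bigr => y _; rewrite mulr_sumr.
under eq_bigr do rewrite HP.
rewrite sumrB sum_stationary (bigD1 x)//= eqxx big1 ?addr0 ?subrr// => y yx.
by rewrite eq_sym (negbTE yx).
Qed.

End Walk.

(** * Subdivision graphs *)

Section Subdivision.
Variables (R : realType) (q : nat) (G : sgraph).
Hypotheses (q_ge1 : (1 <= q)%N) (G_conn : sgraph_connected G)
  (n_ge2 : (2 <= #|{: G}|)%N).
Local Notation mid := ({e : {set G} | e \in edges G} * 'I_q)%type.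
Implicit Types (u v w y : G) (x : mid) (b : subdiv q G).

Lemma sum_mids (P : pred {set G}) (F : {set G} -> R) :
  \sum_(x : mid | P (val x.1)) F (val x.1) =
  q%:R * \sum_(e in edges G | P e) F e.
Proof.
under [LHS]eq_bigl do rewrite -[P _]andbT.
rewrite -(pair_big_dep (fun e => P (val e)) (fun _ _ => true)
  (fun e (l : 'I_q) => F (val e))) /=.
under eq_bigr do rewrite sumr_const card_ord.
by rewrite sumrMnl big_sub_cond mulr_natl.
Qed.

Lemma sum_nbr_vertex (V : nmodType) u (F : subdiv q G -> V) :
  \sum_(b | adj (inl u : subdiv q G) b) F b =
  \sum_(x : mid | u \in val x.1) F (inr x).
Proof.
by rewrite big_sumType /= big_pred0// add0r; apply: eq_bigl => -[e l].
Qed.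

Lemma sum_nbr_mid (V : nmodType) x (F : subdiv q G -> V) :
  \sum_(b | adj (inr x : subdiv q G) b) F b = \sum_(w in val x.1) F (inl w).
Proof. by case: x => e l; rewrite big_sumType /= [X in _ + X]big_pred0// addr0. Qed.

Lemma mid_endpoints x :
  exists2 p : G * G, adj p.1 p.2 & val x.1 = [set p.1; p.2].
Proof. by apply/edgesP; exact: valP x.1. Qed.

Lemma sum_mid_cst x (c : R) : \sum_(w in val x.1) c = 2 * c.
Proof. by have [p pp ->] := mid_endpoints x; rewrite sum_endpoints//; ring. Qed.

Lemma deg_subdiv_vertex u :
  (deg (inl u : subdiv q G))%:R = q%:R * (deg u)%:R :> R.
Proof.
rewrite !natr_deg sum_nbr_vertex.
by rewrite (sum_mids (fun e => u \in e) (fun=> 1)) sum_incident_edges.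
Qed.

Lemma deg_subdiv_mid x : (deg (inr x : subdiv q G))%:R = 2 :> R.
Proof. by rewrite natr_deg sum_nbr_mid sum_mid_cst mulr1. Qed.

Lemma card_subdiv_edges :
  #|edges (subdiv q G)|%:R = 2 * q%:R * #|edges G|%:R :> R.
Proof.
have := sum_deg R (subdiv q G); rewrite big_sumType /=.
under eq_bigr do rewrite deg_subdiv_vertex.
under [X in _ + X]eq_bigr do rewrite deg_subdiv_mid.
rewrite (sum_mids xpredT (fun=> 2)) -mulr_sumr sum_deg.
under [X in _ + _ * X]eq_bigl do rewrite andbT.
rewrite sumr_const -(mulr_natr 2) => E.
by apply: (mulfI (_ : 2 != 0)) => //; rewrite -[LHS]E; ring.
Qed.

Lemma card_subdiv :
  #|{: subdiv q G}|%:R = #|{: G}|%:R + q%:R * #|edges G|%:R :> R.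
Proof.
rewrite card_sum card_prod card_ord card_sig natrD natrM mulrC.
by congr (_ + _ * _%:R); apply: eq_card.
Qed.

Lemma subdiv_connected : sgraph_connected (subdiv q G).
Proof.
have csym := sym_connect_sym (@adj_sym (subdiv q G)).
have vv u v : connect (@adj (subdiv q G)) (inl u) (inl v).
  pose a := [pred y | connect (@adj (subdiv q G)) (inl u) (inl y)].
  have aC : fingraph.closed (@adj G) a.
    apply: (intro_closed (sym_connect_sym (@adj_sym G))) => w y wy.
    rewrite !inE => /connect_trans; apply.
    have eP : [set w; y] \in edges G by apply/edgesP; exists (w, y).
    pose x : subdiv q G := inr (Sub [set w; y] eP, Ordinal q_ge1).
    by apply: (connect_trans (y := x)); apply: connect1; rewrite /= !inE eqxx ?orbT.
  by have := closed_connect aC (G_conn u v); rewrite !inE connect0.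
have tov b : exists u, connect (@adj (subdiv q G)) b (inl u).
  case: b => [u|[e l]]; first by exists u.
  have [[w y] /= _ eE] := mid_endpoints (e, l).
  by exists w; apply: connect1; rewrite /= eE !inE eqxx.
move=> a b; have [[u au] [v bv]] := (tov a, tov b).
by apply: (connect_trans au); apply: (connect_trans (vv u v)); rewrite csym.
Qed.

Lemma subdiv_ge2 : (2 <= #|{: subdiv q G}|)%N.
Proof. by rewrite card_sum (leq_trans n_ge2)// leq_addr. Qed.

Let qR_neq0 : q%:R != 0 :> R.
Proof. by rewrite pnatr_eq0 -lt0n. Qed.

Let degR_neq0 u : (deg u)%:R != 0 :> R.
Proof. by rewrite pnatr_eq0 -lt0n deg_gt0. Qed.

Let mR_neq0 : #|edges G|%:R != 0 :> R.
Proof. by rewrite pnatr_eq0 -lt0n edges_gt0. Qed.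

Lemma stationary_subdiv_vertex v :
  stationary R (inl v : subdiv q G) = stationary R v / 2.
Proof.
rewrite /stationary deg_subdiv_vertex card_subdiv_edges.
by field; rewrite qR_neq0 mR_neq0.
Qed.

Lemma stationary_subdiv_mid x :
  stationary R (inr x : subdiv q G) = 1 / (2 * q%:R * #|edges G|%:R).
Proof.
rewrite /stationary deg_subdiv_mid card_subdiv_edges.
by field; rewrite qR_neq0 mR_neq0.
Qed.

(** * Potential of the subdivision *)

Section Lift.
Variable H : G -> G -> R.

(** The block of rows of the new potential at the old vertices: (2 H, 2 H A),
where A is the block of transition probabilities from vertices to midpoints. *)
Definition potential_row u b : R :=
  match b with
  | inl v => 2 * H u v
  | inr x => 2 * \sum_(w in val x.1) H u w / (q%:R * (deg w)%:R)
  end.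

(** At a midpoint the potential equation only involves the two neighbouring old
vertices, so it determines the row from those already chosen. *)
Definition subdiv_potential (a b : subdiv q G) : R :=
  match a with
  | inl u => potential_row u b
  | inr x => ((inr x : subdiv q G) == b)%:R - stationary R b
             + (\sum_(u in val x.1) potential_row u b) / 2
  end.

Hypothesis HP : potential H.

(** A step to a midpoint followed by the mean over its two ends is the lazy
walk, whence the average of the row at [u] and of its mean over neighbours. *)
Lemma walk_mean_subdiv_potential u b :
  walk_mean (subdiv_potential ^~ b) (inl u : subdiv q G) =
  (\sum_(x : mid | u \in val x.1) ((inr x : subdiv q G) == b)%:R)
     / (q%:R * (deg u)%:R)
  - stationary R b
  + (potential_row u b + walk_mean (potential_row ^~ b) u) / 2.
Proof.
rewrite walk_meanE deg_subdiv_vertex sum_nbr_vertex /=.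
rewrite big_split sumrB /=.
rewrite (sum_mids (fun e => u \in e) (fun=> stationary R b)).
rewrite (sum_mids (fun e => u \in e)
  (fun e => (\sum_(w in e) potential_row w b) / 2)).
rewrite !sum_incident_edges walk_meanE.
under [X in _ + _ * X]eq_bigr => y uy do rewrite sum_endpoints// mulrDl.
rewrite big_split /= -[X in _ + _ * (_ + X)]mulr_suml.
have cE (c : R) : \sum_(y | adj u y) c = (deg u)%:R * c.
  by rewrite natr_deg mulr_suml; apply: eq_bigr => y _; rewrite mul1r.
by rewrite !cE; field; rewrite qR_neq0 degR_neq0.
Qed.

Lemma potential_row_laplacian_vertex u v :
  potential_row u (inl v) - walk_mean (potential_row ^~ (inl v)) u =
  2 * ((u == v)%:R - stationary R v).
Proof.
rewrite -HP mulrBr /=; congr (_ - _).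
by rewrite mulr_sumr; apply: eq_bigr => y _; rewrite mulrCA.
Qed.

(** The vertex-to-midpoint block A has the entry [u \in x] / (q deg u), and
pi A is the constant 1 / (q m), because each midpoint has two ends. *)
Lemma potential_row_laplacian_mid u x :
  potential_row u (inr x) - walk_mean (potential_row ^~ (inr x)) u =
  2 * (u \in val x.1)%:R / (q%:R * (deg u)%:R) - 2 / (q%:R * #|edges G|%:R).
Proof.
transitivity (2 * \sum_(w in val x.1)
    (H u w - walk_mean (H ^~ w) u) / (q%:R * (deg w)%:R)).
  rewrite /=; under [in RHS]eq_bigr do rewrite mulrBl.
  rewrite sumrB mulrBr; congr (_ - _).
  rewrite /walk_mean; under eq_bigr do rewrite mulrCA.
  rewrite -mulr_sumr; congr (_ * _).
  under [in RHS]eq_bigr do rewrite mulr_suml.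
  rewrite exchange_big /=; apply: eq_bigr => y _.
  by rewrite mulr_sumr; apply: eq_bigr => w _; rewrite mulrA.
under eq_bigr do rewrite HP mulrBl.
rewrite sumrB mulrBr; congr (_ - _).
  rewrite -mulrA; congr (_ * _); case: (boolP (u \in val x.1)) => ux.
    rewrite (bigD1 u)//= eqxx big1 ?addr0// => w /andP[_ wu].
    by rewrite eq_sym (negbTE wu) mul0r.
  rewrite mul0r big1// => w wx.
  by have [uw|_] := eqVneq u w; [rewrite uw wx in ux|rewrite mul0r].
rewrite (eq_bigr (fun=> 1 / (2 * q%:R * #|edges G|%:R))) => [|w _].
  by rewrite sum_mid_cst; field; rewrite qR_neq0 mR_neq0.
by rewrite /stationary; field; rewrite qR_neq0 mR_neq0 degR_neq0.
Qed.

Lemma subdiv_potentialP : potential subdiv_potential.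
Proof.
case=> [u|x] b; last first.
  rewrite walk_meanE deg_subdiv_mid sum_nbr_mid /=; ring.
rewrite walk_mean_subdiv_potential /=.
case: b => [v|x].
  have := potential_row_laplacian_vertex u v.
  rewrite big1 ?mul0r// stationary_subdiv_vertex /=.
  rewrite (inj_eq (@inl_inj _ _)); lra.
have := potential_row_laplacian_mid u x.
rewrite stationary_subdiv_mid (_ : \sum_(_ | _) _ = (u \in val x.1)%:R).
  set r := potential_row _ _; set m := walk_mean _ _ => E.
  rewrite (_ : m = r - (2 * (u \in val x.1)%:R / (q%:R * (deg u)%:R)
    - 2 / (q%:R * #|edges G|%:R))) /=; last by rewrite -E; ring.
  by field; rewrite qR_neq0 mR_neq0 degR_neq0.
rewrite big_mkcond (bigD1 x)//= eqxx big1 ?addr0 => [|y yx].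
  by case: (u \in _).
by rewrite (inj_eq (@inr_inj _ _)) (negbTE yx) if_same.
Qed.

Lemma sum_potential_row u : \sum_b potential_row u b = 4 * \sum_v H u v.
Proof.
rewrite big_sumType /= -!mulr_sumr.
rewrite (sum_mids xpredT (fun e => \sum_(w in e) H u w / (q%:R * (deg w)%:R))).
under [X in _ + 2 * (_ * X)]eq_bigl do rewrite andbT.
rewrite (sum_edges_endpoints (fun _ w => H u w / (q%:R * (deg w)%:R))).
have -> : \sum_w \sum_(y | adj w y) H u w / (q%:R * (deg w)%:R) =
          (\sum_w H u w) / q%:R.
  rewrite mulr_suml; apply: eq_bigr => w _.
  rewrite (eq_bigr (fun=> 1 * (H u w / (q%:R * (deg w)%:R)))) => [|y _].
    by rewrite -mulr_suml -natr_deg; field; rewrite qR_neq0 degR_neq0.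
  by rewrite mul1r.
by field; rewrite qR_neq0.
Qed.

(** The midpoints contribute q m (1 - 1 / (2 q m)) from the explicit terms, and
tr (H (I + P)) from the products; the latter is 2 tr H - n + 1, by taking the
trace of the potential equation. *)
Lemma trace_subdiv_potential :
  \sum_b subdiv_potential b b =
  4 * \sum_v H v v + (q%:R * #|edges G|%:R - #|{: G}|%:R + 1 / 2).
Proof.
rewrite big_sumType /= -mulr_sumr.
have -> : \sum_(x : mid) (((inr x : subdiv q G) == inr x)%:R
      - stationary R (inr x : subdiv q G)
      + (\sum_(u in val x.1) potential_row u (inr x)) / 2) =
    \sum_(x : mid) ((1 - 1 / (2 * q%:R * #|edges G|%:R))
      + \sum_(w in val x.1) \sum_(u in val x.1) H u w / (q%:R * (deg w)%:R)).
  apply: eq_bigr => x _; rewrite eqxx stationary_subdiv_mid; congr (_ + _).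
  by rewrite /= -mulr_sumr [RHS]exchange_big /=; field.
rewrite (sum_mids xpredT (fun e => (1 - 1 / (2 * q%:R * #|edges G|%:R))
      + \sum_(w in e) \sum_(u in e) H u w / (q%:R * (deg w)%:R))).
under [X in _ + _ * X]eq_bigl do rewrite andbT.
rewrite big_split /= sumr_const.
rewrite (sum_edges_endpoints
  (fun e w => \sum_(u in e) H u w / (q%:R * (deg w)%:R))).
have -> : \sum_w \sum_(y | adj w y)
      \sum_(u in [set w; y]) H u w / (q%:R * (deg w)%:R) =
    (2 * \sum_v H v v - #|{: G}|%:R + 1) / q%:R.
  transitivity (\sum_w (2 * H w w - 1 + stationary R w) / q%:R).
    apply: eq_bigr => w _; have := HP w w; rewrite eqxx walk_meanE => E.
    under eq_bigr => y wy do rewrite sum_endpoints//.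
    rewrite big_split /= -[X in _ + X]mulr_suml.
    rewrite (eq_bigr (fun=> 1 * (H w w / (q%:R * (deg w)%:R)))) => [|y _].
      rewrite -mulr_suml -natr_deg.
      have -> : stationary R w =
          1 - (H w w - (\sum_(y | adj w y) H y w) / (deg w)%:R).
        by rewrite E mulr1n; ring.
      by field; rewrite qR_neq0 degR_neq0.
    by rewrite mul1r.
  rewrite -mulr_suml big_split sumrB /= -mulr_sumr sum_stationary//.
  by rewrite sumr_const.
rewrite -(mulr_natr (1 - _)).
by field; rewrite qR_neq0 mR_neq0.
Qed.

End Lift.

Lemma kemeny_subdiv (i : G) (i' : subdiv q G) :
  kemeny R i' = (4%:E * kemeny R i
    + (q%:R * #|edges G|%:R - #|{: G}|%:R + 1 / 2)%:E)%E.
Proof.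
have [H HP] := exists_potential R G_conn n_ge2.
have HP' := subdiv_potentialP HP.
rewrite (kemeny_potential subdiv_connected subdiv_ge2 i' HP').
rewrite (kemeny_potential G_conn n_ge2 i HP) -EFinM -EFinD; congr (_%:E).
rewrite !sumrB trace_subdiv_potential//.
rewrite (potential_sum_cst subdiv_connected subdiv_ge2 i' (inl i) HP') /=.
rewrite sum_potential_row; ring.
Qed.

End Subdivision.

(** * Iterated subdivisions *)

Section Iteration.
Variables (R : realType) (q : nat) (G : sgraph).
Hypotheses (q_ge1 : (1 <= q)%N) (G_conn : sgraph_connected G)
  (n_ge2 : (2 <= #|{: G}|)%N).
Local Notation n := (#|{: G}|%:R : R).
Local Notation m := (#|edges G|%:R : R).
Local Notation Q := (q%:R : R).

Lemma iter_subdiv_connected_ge2 k :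
  sgraph_connected (iter_subdiv q k G) /\ (2 <= #|{: iter_subdiv q k G}|)%N.
Proof.
elim: k => [//|k [c g]]; split; first exact: subdiv_connected.
exact: subdiv_ge2.
Qed.

Lemma card_iter_subdiv_edges k :
  #|edges (iter_subdiv q k G)|%:R = (2 * Q) ^+ k * m.
Proof.
elim: k => [|k IH]; first by rewrite expr0 mul1r.
have [c g] := iter_subdiv_connected_ge2 k.
by rewrite [LHS]card_subdiv_edges IH exprS; ring.
Qed.

Lemma double_subr1_neq0 : 2 * Q - 1 != 0.
Proof.
have : 1 <= Q by rewrite ler1n.
by move=> Q1; rewrite gt_eqF//; lra.
Qed.

Lemma card_iter_subdiv k :
  #|{: iter_subdiv q k G}|%:R =
  n + Q * m * (((2 * Q) ^+ k - 1) / (2 * Q - 1)).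
Proof.
elim: k => [|k IH]; first by rewrite expr0 subrr mul0r mulr0 addr0.
rewrite [LHS]card_subdiv IH card_iter_subdiv_edges exprS.
by field; exact: double_subr1_neq0.
Qed.

(** Both closed forms are instances, for a solution [D] of the recurrence that
[kemeny_subdiv] gives with the edge and vertex counts of the k-th iterate. *)
Lemma kemeny_iter_subdiv (D : nat -> R) :
  D 0 = 0 ->
  (forall k, D k.+1 = 4 * D k + (Q * ((2 * Q) ^+ k * m)
     - (n + Q * m * (((2 * Q) ^+ k - 1) / (2 * Q - 1))) + 1 / 2)) ->
  forall k (i0 : G) (i : iter_subdiv q k G),
  kemeny R i = ((4 ^+ k)%:E * kemeny R i0 + (D k)%:E)%E.
Proof.
move=> D0 DS k i0; have [H HP] := exists_potential R G_conn n_ge2.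
have KE := @kemeny_potential R G G_conn n_ge2 H ^~ HP.
elim: k => [|k IH] i.
  rewrite D0 expr0 mul1e adde0 !KE !sumrB.
  by rewrite (potential_sum_cst G_conn n_ge2 i i0 HP).
have [c g] := iter_subdiv_connected_ge2 k.
have /card_gt0P [a _] : (0 < #|{: iter_subdiv q k G}|)%N by exact: ltnW.
rewrite (kemeny_subdiv R q_ge1 c g a i) IH KE -!(EFinM, EFinD).
rewrite card_iter_subdiv card_iter_subdiv_edges DS exprS.
by congr (_%:E); ring.
Qed.

End Iteration.

Theorem theorem7p1 (R : realType) (q k : nat) (G : sgraph)
    (q_ge1 : (1 <= q)%N) (G_conn : sgraph_connected G)
    (n_ge2 : (2 <= #|{: G}|)%N)
    (i0 : iter_subdiv q 0 G) (i : iter_subdiv q k G) :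
  let n : R := #|{: G}|%:R in
  let m : R := #|edges G|%:R in
  let Q : R := q%:R in
  (q = 2%N ->
    kemeny R i =
      ((4 ^+ k)%:E * kemeny R i0
       + (m * k%:R * 4 ^+ k / 3
          + ((4 * m + 3) / 6 - n) * ((4 ^+ k - 1) / 3))%:E)%E)
  /\
  (q <> 2%N ->
    kemeny R i =
      ((4 ^+ k)%:E * kemeny R i0
       + (m * Q * (Q - 1) / ((Q - 2) * (2 * Q - 1))
            * ((2 * Q) ^+ k - 4 ^+ k)
          + ((2 * m * Q + 2 * Q - 1) / (2 * (2 * Q - 1)) - n)
            * ((4 ^+ k - 1) / 3))%:E)%E).
Proof.
move=> n m Q; split=> [q2|/eqP q2].
  pose D j : R := m * j%:R * 4 ^+ j / 3
    + ((4 * m + 3) / 6 - n) * ((4 ^+ j - 1) / 3).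
  apply: (kemeny_iter_subdiv q_ge1 G_conn n_ge2 (D := D)) => [|j].
    by rewrite /D expr0 subrr !(mul0r, mulr0, addr0).
  have Q2 : q%:R = 2 :> R by rewrite q2.
  rewrite Q2 (_ : 2 * 2 = 4); last by ring.
  by rewrite /D -natr1 exprS -/n -/m; field.
pose D j : R := m * Q * (Q - 1) / ((Q - 2) * (2 * Q - 1))
    * ((2 * Q) ^+ j - 4 ^+ j)
  + ((2 * m * Q + 2 * Q - 1) / (2 * (2 * Q - 1)) - n) * ((4 ^+ j - 1) / 3).
apply: (kemeny_iter_subdiv q_ge1 G_conn n_ge2 (D := D)) => [|j].
  by rewrite /D !expr0 !subrr !(mul0r, mulr0, addr0).
rewrite /D -/Q -/n -/m !exprS.
field; rewrite double_subr1_neq0//= subr_eq0 /Q.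
by rewrite (eqr_nat R q 2) q2.
Qed.
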